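(* Let $T$ be a tree that contains a leaf whose neighbor has degree $2$. Then $T$ is a good tree.
   Context: All graphs are simple, finite and undirected; $e(G)$ denotes the number of edges of $G$. A leaf is a vertex of degree $1$. Given a graph $F$, a graph $G$ is weakly $F$-saturated if the non-edges of $G$ can be added one by one in some order, ending with the complete graph on $V(G)$, so that each newly added edge creates a new copy of $F$ (a subgraph isomorphic to $F$, not necessarily induced, containing the new edge). For an integer $n$, $\text{w-sat}(n,F)$ is the minimum number of edges of an $n$-vertex weakly $F$-saturated graph. For a tree $T$ with at least one edge, $\text{w-sat}(n,T)$ is constant for all sufficiently large $n$, and $\text{w-sat}(T)$ denotes this limit value. A tree $T$ is called good if $\text{w-sat}(T)=e(T)-1$. *)

(* Defs.v *)
From HB Require Import structures.
From mathcomp Require Import all_boot.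

Set Implicit Arguments.
Unset Strict Implicit.
Unset Printing Implicit Defensive.

(* A simple graph on the vertex set V, given by its edges, which are
   two-element subsets of V. *)
Record sgraph (V : finType) := SGraph {
  edges : {set {set V}};
  edgesP : [forall e in edges, #|e| == 2]
}.

HB.instance Definition _ (V : finType) := [isSub for @edges V].
HB.instance Definition _ (V : finType) := [Finite of sgraph V by <:].

Section Graphs.
Variable V : finType.
Implicit Type G : sgraph V.

Definition num_edges G : nat := #|edges G|.

Definition adj G : rel V := fun x y => [set x; y] \in edges G.

Definition degree G (x : V) : nat := #|[set y | adj G x y]|.

Definition leaf G (x : V) : Prop := degree G x = 1.

Definition connected G : Prop :=
  0 < #|V| /\ forall x y : V, connect (adj G) x y.

(* In the sense of [cycle], the two ends of an edge form a cycle of size 2;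
   a graph-theoretic cycle has at least 3 vertices. *)
Definition acyclic G : Prop :=
  forall p : seq V, cycle (adj G) p -> uniq p -> size p < 3.

Definition is_tree G : Prop := connected G /\ acyclic G.

Definition non_edges G : {set {set V}} :=
  [set e : {set V} | (#|e| == 2) && (e \notin edges G)].

Fact complete_subproof :
  [forall e in [set e : {set V} | #|e| == 2], #|e| == 2].
Proof. by apply/forall_inP => e; rewrite inE. Qed.

Definition complete : sgraph V := SGraph complete_subproof.

End Graphs.

Section Saturation.
Variables (U V : finType) (F : sgraph U).

Definition copy_edges (f : U -> V) : {set {set V}} :=
  [set f @: d | d : {set U} in edges F].

(* Adding e to the graph with edge set E creates a copy of F that uses e. *)
Definition creates_copy (E : {set {set V}}) (e : {set V}) : bool :=
  [exists f : {ffun U -> V},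
    [&& injectiveb f, copy_edges f \subset e |: E & e \in copy_edges f]].

Fixpoint saturating (E : {set {set V}}) (s : seq {set V}) : bool :=
  if s is e :: s' then creates_copy E e && saturating (e |: E) s' else true.

Definition weakly_saturated (G : sgraph V) : bool :=
  has (saturating (edges G)) (permutations (enum (non_edges G))).

Lemma weakly_saturatedP (G : sgraph V) :
  reflect (exists2 s, perm_eq s (enum (non_edges G)) & saturating (edges G) s)
          (weakly_saturated G).
Proof.
apply: (iffP hasP) => [] [s sP sat]; exists s => //.
  by rewrite -mem_permutations.
by rewrite mem_permutations.
Qed.

Lemma weakly_saturated_complete : weakly_saturated (complete V).
Proof.
apply/weakly_saturatedP; exists [::] => //.
rewrite (_ : non_edges _ = set0) ?enum_set0 //.
by apply/setP => e; rewrite !inE andbN.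
Qed.

End Saturation.

Definition wsat (n : nat) (U : finType) (F : sgraph U) : nat :=
  num_edges [arg min_(G < complete 'I_n | weakly_saturated F G) num_edges G].

Lemma wsat_attained (n : nat) (U : finType) (F : sgraph U) :
  exists2 G : sgraph 'I_n, weakly_saturated F G & num_edges G = wsat n F.
Proof.
rewrite /wsat; case: arg_minnP => [|G satG _].
  exact: weakly_saturated_complete.
by exists G.
Qed.

Lemma wsat_min (n : nat) (U : finType) (F : sgraph U) (G : sgraph 'I_n) :
  weakly_saturated F G -> wsat n F <= num_edges G.
Proof.
rewrite /wsat; case: arg_minnP => [|H _ minH]; last exact: minH.
exact: weakly_saturated_complete.
Qed.

(* c is the constant value of w-sat(n, F) for all sufficiently large n. *)
Definition wsat_limit (U : finType) (F : sgraph U) (c : nat) : Prop :=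
  exists N : nat, forall n : nat, N <= n -> wsat n F = c.

(* Meaningful for trees with at least one edge: the subtraction is truncated. *)
Definition good (U : finType) (T : sgraph U) : Prop :=
  wsat_limit T (num_edges T - 1).

(* Main.v *)
Require Import Defs.
From mathcomp Require Import all_boot.

(** Write F for the tree, x for the leaf, y for its neighbor and z for the
    other neighbor of y.

    Lower bound.  The first edge added to a weakly F-saturated graph completes
    a copy of F, all of whose other edges were there already
    ([num_edges_weakly_saturated]).

    Upper bound.  Start from a copy of F without the edge xy, inside a large
    vertex set.  By [weakly_saturated_closed], what can be added in some order
    can be studied through the edge sets E that contain the start and are
    closed, that is, to which no further edge can be added with a new copy of
    F; the point is that such an E is complete.  Whenever F minus {x, y} is
    copied in E by k, and a, b are two vertices off that copy, the path
    a - b - k z would complete a copy of F, so each of its two edges forces the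
    other one into E ([attach_path]).  Let S be the set of vertices off the
    initial copy of F minus {x, y}; it contains the initial vertex y.
    - The edge yz forces all edges from y to S; these force all edges from z to
      S, which in turn force all edges inside S: S is a clique
      ([clique_off_copy]).
    - As S is large, F minus {x, y} can now be copied inside S, away from any
      two prescribed vertices a and b.  If b is in S, the edge b - k z is in
      the clique, hence ab is in E; so every vertex is joined to all of S, and
      then the same argument gives ab for arbitrary a and b
      ([complete_of_clique]). *)

Set Implicit Arguments.
Unset Strict Implicit.
Unset Printing Implicit Defensive.

Lemma exists_injection (U W : finType) (A : {set W}) :
  #|U| <= #|A| -> exists2 k : U -> W, injective k & forall u, k u \in A.
Proof.
move=> leUA; exists (fun u => enum_val (widen_ord leUA (enum_rank u))).
  move=> u v /enum_val_inj /(congr1 val) /= /val_inj; exact: enum_rank_inj.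
by move=> u; apply: enum_valP.
Qed.

(** * Leaves and vertices of degree 2 *)

Section Adjacency.
Variables (U : finType) (F : sgraph U).

Lemma adjC u v : adj F u v = adj F v u.
Proof. by rewrite /adj setUC. Qed.

Lemma adj_neq u v : adj F u v -> u != v.
Proof.
move=> uv; have /forall_inP /(_ _ uv) := edgesP F.
by rewrite cards2; case: (u != v).
Qed.

Lemma edges_adj d : d \in edges F -> exists u v, d = [set u; v] /\ adj F u v.
Proof.
move=> dF; have /forall_inP /(_ _ dF) /cards2P [u [v [_ def_d]]] := edgesP F.
by exists u, v; rewrite /adj -def_d.
Qed.

Lemma leaf_neighbor x y v : leaf F x -> adj F x y -> adj F x v -> v = y.
Proof.
move=> /eqP /cards1P [w nbrs] xy xv.
have: y \in [set u | adj F x u] by rewrite inE.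
have: v \in [set u | adj F x u] by rewrite inE.
by rewrite nbrs !inE => /eqP -> /eqP ->.
Qed.

Lemma degree2_neighbor x y : degree F y = 2 -> adj F y x ->
  exists z, [/\ adj F y z, z != x & forall v, adj F y v -> v = x \/ v = z].
Proof.
rewrite /degree (cardsD1 x) inE => deg2 yx; move: deg2; rewrite yx add1n.
case=> /eqP /cards1P [z nbrs].
have: z \in [set u | adj F y u] :\ x by rewrite nbrs inE.
rewrite !inE => /andP [zx yz]; exists z; split=> // v yv.
have [-> | vx] := eqVneq v x; [by left | right].
have: v \in [set u | adj F y u] :\ x by rewrite !inE vx.
by rewrite nbrs inE => /eqP.
Qed.

End Adjacency.

(** * Closed edge sets *)

Section Closure.
Variables (U V : finType) (F : sgraph U).

Definition copy_closed (E : {set {set V}}) : Prop :=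
  forall e, creates_copy F E e -> e \in E.

Lemma copy_closed_edge (E : {set {set V}}) (f : U -> V) d :
    copy_closed E -> injective f -> d \in edges F ->
    (forall d', d' \in edges F -> d' != d -> f @: d' \in E) ->
  f @: d \in E.
Proof.
move=> closE injf dF restE; apply: closE; apply/existsP; exists (finfun f).
have imE (d' : {set U}) : finfun f @: d' = f @: d'.
  by apply: eq_imset => u; rewrite ffunE.
apply/and3P; split.
- by apply/injectiveP => u v; rewrite !ffunE => /injf.
- apply/subsetP => _ /imsetP [d' d'F ->]; rewrite imE !inE.
  have [-> | d'd] := eqVneq d' d; first by rewrite eqxx.
  by rewrite restE // orbT.
- by apply/imsetP; exists d.
Qed.

Lemma creates_copy_card2 (E : {set {set V}}) e :
  creates_copy F E e -> #|e| = 2.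
Proof.
case/existsP => f /and3P [/injectiveP injf _ /imsetP [d dF ->]].
by rewrite card_imset //; apply/eqP; have /forall_inP := edgesP F; apply.
Qed.

(** Adding, as long as possible, any edge that creates a copy of F ends at a
    closed set; hence no order of the edges has to be exhibited. *)
Lemma weakly_saturated_closed (G : sgraph V) :
    (forall E : {set {set V}}, edges G \subset E -> copy_closed E ->
       forall e : {set V}, #|e| = 2 -> e \in E) ->
  weakly_saturated F G.
Proof.
move=> complE.
pose missing (E : {set {set V}}) :=
  [set e : {set V} | (#|e| == 2) && (e \notin E)].
have reach (E : {set {set V}}) : edges G \subset E ->
    exists2 s, uniq s & s =i missing E /\ saturating F E s.
  have [m] := ubnP #|missing E|; elim: m E => // m IHm E ltEm subGE.
  have [e /andP [copy_e eE] | no_copy] :=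
      pickP [pred e : {set V} | creates_copy F E e && (e \notin E)].
    have defE : missing (e |: E) = missing E :\ e.
      by apply/setP => d; rewrite !inE negb_or andbCA.
    have e_missing : e \in missing E.
      by rewrite inE (creates_copy_card2 copy_e) eqxx.
    case: (IHm (e |: E)) => [||s uniq_s [mem_s sat_s]].
    - by move: ltEm; rewrite defE (cardsD1 e) e_missing.
    - exact: subset_trans subGE (subsetUr _ _).
    exists (e :: s); first by rewrite /= mem_s defE !inE eqxx.
    split; last by rewrite /= copy_e.
    by move=> d; rewrite -(setD1K e_missing) -defE inE mem_s in_setU1.
  (* No edge can be added: E is closed, hence complete. *)
  exists [::] => //; split=> // d; rewrite !inE.
  apply/esym/negP => /andP [/eqP d2]; apply/negP; rewrite negbK.
  apply: complE d2 => // e copy_e; have := no_copy e.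
  by rewrite /= copy_e => /negbFE.
have [s uniq_s [mem_s sat_s]] := reach _ (subxx _).
apply/weakly_saturatedP; exists s => //.
by apply: uniq_perm => [||e]; rewrite ?enum_uniq // mem_enum mem_s.
Qed.

(** If G misses an edge, the first edge added completes a copy of F; if G is
    complete, it contains a copy of F because V is large enough. *)
Lemma num_edges_weakly_saturated (G : sgraph V) :
  #|U| <= #|V| -> weakly_saturated F G -> num_edges F <= (num_edges G).+1.
Proof.
move=> leUV /weakly_saturatedP [s perm_s sat_s].
have card_copy (f : U -> V) : injective f -> #|copy_edges F f| = num_edges F.
  by move=> injf; apply: card_imset; apply: imset_inj.
case: s perm_s sat_s => [|e s] perm_s /=.
  move=> _; rewrite -[#|V|]cardsT in leUV; have [f injf _] := exists_injection leUV.
  rewrite -(card_copy f injf) leqW // subset_leq_card //.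
  apply/subsetP => _ /imsetP [d dF ->]; apply/negPn/negP => dG.
  have := perm_mem perm_s (f @: d); rewrite mem_enum !inE dG card_imset //.
  by have /forall_inP -> := edgesP F.
case/andP => /existsP [f /and3P [/injectiveP injf sub_f _]] _.
rewrite -(card_copy f injf) (leq_trans (subset_leq_card sub_f)) //.
by rewrite cardsU1 -add1n leq_add2r leq_b1.
Qed.

End Closure.

(** * Graphs with a pendant path of two edges *)

Section PendantPath.
Variables (U V : finType) (F : sgraph U) (x y z : U).
Hypotheses (xy : adj F x y) (yz : adj F y z) (zx : z != x).
Hypothesis nbr_x : forall v, adj F x v -> v = y.
Hypothesis nbr_y : forall v, adj F y v -> v = x \/ v = z.
Variable E : {set {set V}}.
Hypothesis closE : copy_closed F E.

(** Copies in E of F without its pendant path; k may send x and y anywhere. *)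
Definition core_copy (k : U -> V) : Prop :=
  forall u v, u \notin [set x; y] -> v \notin [set x; y] -> adj F u v ->
  [set k u; k v] \in E.

Lemma pendant_edge_cases d : d \in edges F ->
  [\/ d = [set x; y], d = [set y; z] |
      exists u v, [/\ d = [set u; v], adj F u v,
                      u \notin [set x; y] & v \notin [set x; y]]].
Proof.
case/edges_adj => u [v [-> uv]].
have [ux | ux] := eqVneq u x.
  by move: uv; rewrite ux => /nbr_x ->; constructor 1.
have [vx | vx] := eqVneq v x.
  by move: uv; rewrite vx adjC => /nbr_x ->; rewrite setUC; constructor 1.
have [uy | uy] := eqVneq u y.
  move: uv; rewrite uy => /nbr_y [vx' | ->]; last by constructor 2.
  by rewrite vx' eqxx in vx.
have [vy | vy] := eqVneq v y.
  move: uv; rewrite vy adjC => /nbr_y [ux' | ->].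
    by rewrite ux' eqxx in ux.
  by rewrite setUC; constructor 2.
by constructor 3; exists u, v; rewrite !inE !negb_or ux uy vx vy.
Qed.

(** The copy of F that sends x to a, y to b and is k elsewhere lacks at most
    the edges ab and b(k z): when one of them is present, adding the other one
    completes the copy. *)
Lemma attach_path (k : U -> V) a b :
    injective k -> core_copy k -> a != b ->
    (forall v, v \notin [set x; y] -> k v != a /\ k v != b) ->
  ([set a; b] \in E) = ([set b; k z] \in E).
Proof.
move=> injk coreE ab off_ab.
pose f v := if v == x then a else if v == y then b else k v.
have xney := adj_neq xy; have ynez := adj_neq yz.
have fx : f x = a by rewrite /f eqxx.
have fy : f y = b by rewrite /f eq_sym (negPf xney) eqxx.
have fk v : v \notin [set x; y] -> f v = k v.
  by rewrite !inE negb_or /f => /andP [/negPf -> /negPf ->].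
have fz : f z = k z by rewrite fk // !inE negb_or zx eq_sym.
have injf : injective f.
  have off v : v != x -> v != y -> k v != a /\ k v != b.
    by move=> vx vy; apply: off_ab; rewrite !inE negb_or vx.
  move=> u v; rewrite /f.
  case: (eqVneq u x) => [->|ux]; case: (eqVneq v x) => [->|vx] //.
  - case: (eqVneq v y) => [_|vy] eq_ab; first by rewrite eq_ab eqxx in ab.
    by case: (off v vx vy); rewrite eq_ab eqxx.
  - case: (eqVneq u y) => [_|uy] eq_ab; first by rewrite eq_ab eqxx in ab.
    by case: (off u ux uy); rewrite eq_ab eqxx.
  case: (eqVneq u y) => [->|uy]; case: (eqVneq v y) => [->|vy] // eq_k.
  - by case: (off v vx vy); rewrite eq_k eqxx.
  - by case: (off u ux uy); rewrite eq_k eqxx.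
  exact: injk.
have im_xy : f @: [set x; y] = [set a; b] by rewrite imsetU1 imset_set1 fx fy.
have im_yz : f @: [set y; z] = [set b; k z].
  by rewrite imsetU1 imset_set1 fy fz.
have im_core u v : adj F u v -> u \notin [set x; y] -> v \notin [set x; y] ->
    f @: [set u; v] \in E.
  by move=> uv u_xy v_xy; rewrite imsetU1 imset_set1 !fk // coreE.
apply/idP/idP; rewrite -im_xy -im_yz => inE';
  apply: (copy_closed_edge closE injf) => // d dF;
  by case: (pendant_edge_cases dF) => [->|->|[u [v [-> uv ? ?]]]];
     rewrite ?eqxx // => _; apply: im_core.
Qed.

Lemma clique_off_copy (g : U -> V) (S := ~: (g @: ~: [set x; y])) :
    injective g -> core_copy g -> [set g y; g z] \in E ->
  forall a b, a \in S -> b \in S -> a != b -> [set a; b] \in E.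
Proof.
move=> injg coreE gyz.
have off a v : a \in S -> v \notin [set x; y] -> g v != a.
  move=> aS v_xy; apply: contraTneq aS => <-.
  by rewrite inE negbK imset_f // inE.
have path_eq a b : a \in S -> b \in S -> a != b ->
    ([set a; b] \in E) = ([set b; g z] \in E).
  by move=> aS bS ab; apply: attach_path => // v v_xy; rewrite !off.
have gyS : g y \in S.
  by rewrite inE mem_imset // !inE eqxx orbT.
have joined_gy a : a \in S -> a != g y -> [set a; g y] \in E.
  by move=> aS a_gy; rewrite path_eq.
move=> a b aS bS ab; rewrite path_eq //.
have [-> // | b_gy] := eqVneq b (g y).
by rewrite -(path_eq (g y)) // 1?eq_sym // setUC joined_gy.
Qed.

(** The bound leaves room for a copy of F inside S that avoids two given
    vertices. *)
Lemma complete_of_clique (S : {set V}) :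
    #|U| + 2 <= #|S| ->
    (forall a b, a \in S -> b \in S -> a != b -> [set a; b] \in E) ->
  forall a b, a != b -> [set a; b] \in E.
Proof.
move=> largeS cliqueS.
have join a b : a != b ->
    (forall s, s \in S -> s != b -> [set b; s] \in E) -> [set a; b] \in E.
  move=> ab joined_b.
  have large : #|U| <= #|S :\: [set a; b]|.
    rewrite -(leq_add2r 2) (leq_trans largeS) // -(cardsID [set a; b] S) addnC.
    rewrite leq_add2l (leq_trans (subset_leq_card (subsetIr _ _))) //.
    by rewrite cards2 ab.
  have [k injk kS] := exists_injection large.
  have off v : [/\ k v \in S, k v != a & k v != b].
    by have:= kS v; rewrite !inE negb_or -andbA => /and3P [].
  rewrite (attach_path (k := k)) //.
  - by have [kzS _ kzb] := off z; apply: joined_b.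
  - move=> u v _ _ uv; have [uS _ _] := off u; have [vS _ _] := off v.
    by rewrite cliqueS // (inj_eq injk) (adj_neq uv).
  - by move=> v _; have [] := off v.
(* The clique property is the hypothesis of join for b in S; the conclusion of
   join for all such b is, read backwards, its hypothesis for every vertex. *)
move=> a b ab; apply: (join) => // s sS sb.
apply: join => [|t tS ts]; first by rewrite eq_sym.
by apply: cliqueS; rewrite // eq_sym.
Qed.

End PendantPath.

(** * The weak saturation number *)

Section DeleteEdge.
Variables (U V : finType) (F : sgraph U) (g : U -> V) (d : {set U}).
Hypothesis injg : injective g.

Let E := [set g @: c | c : {set U} in edges F :\ d].

Fact copy_minus_edge_subproof : [forall e in E, #|e| == 2].
Proof.
apply/forall_inP => _ /imsetP [c /setD1P [_ cF] ->].
by rewrite card_imset //; have /forall_inP := edgesP F; apply.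
Qed.

Definition copy_minus_edge : sgraph V := SGraph copy_minus_edge_subproof.

Lemma num_edges_copy_minus_edge :
  d \in edges F -> num_edges copy_minus_edge = num_edges F - 1.
Proof.
move=> dF; rewrite /num_edges card_imset; last exact: imset_inj.
by rewrite (cardsD1 d (edges F)) dF addKn.
Qed.

End DeleteEdge.

Lemma weakly_saturated_pendant_path (U V : finType) (F : sgraph U) (x y : U)
    (g : U -> V) (injg : injective g) :
    leaf F x -> adj F x y -> degree F y = 2 -> #|U|.*2 <= #|V| ->
  weakly_saturated F (copy_minus_edge F [set x; y] injg).
Proof.
move=> leaf_x xy deg_y largeV; have yx : adj F y x by rewrite adjC.
have [z [yz zx nbr_y]] := degree2_neighbor deg_y yx.
have nbr_x v : adj F x v -> v = y by apply: leaf_neighbor.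
apply: weakly_saturated_closed => E /subsetP subE closE e /eqP.
case/cards2P => a [b [ab ->]].
have gE u v : adj F u v -> [set u; v] != [set x; y] -> [set g u; g v] \in E.
  move=> uv uv_xy; apply: subE; apply/imsetP; exists [set u; v].
    by rewrite in_setD1 uv_xy.
  by rewrite imsetU1 imset_set1.
have core_g : core_copy F x y E g.
  move=> u v u_xy _ uv; apply: gE => //.
  by apply: contraNneq u_xy => <-; rewrite set21.
have gyz : [set g y; g z] \in E.
  apply: gE => //; apply/eqP => /setP /(_ z).
  by rewrite !inE eqxx orbT (negPf zx) eq_sym (negPf (adj_neq yz)).
have clique := clique_off_copy xy yz zx nbr_x nbr_y closE injg core_g gyz.
apply: (complete_of_clique xy yz zx nbr_x nbr_y closE _ clique ab).
have := cardsC (g @: ~: [set x; y]); rewrite card_imset // => cardS.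
have := cardsC [set x; y]; rewrite cards2 (adj_neq xy) => cardU.
rewrite -(leq_add2l #|~: [set x; y]|) cardS addnCA [_ + 2]addnC cardU.
by rewrite addnn.
Qed.

Theorem lemma4p1 (V : finType) (T : sgraph V) (hT : is_tree T)
    (hleaf : exists x y : V, [/\ leaf T x, adj T x y & degree T y = 2]) :
  good T.
Proof.
have [x [y [leaf_x xy deg_y]]] := hleaf.
exists #|V|.*2 => n large_n; have leVn : #|V| <= n.
  by rewrite (leq_trans _ large_n) // -addnn leq_addr.
apply/eqP; rewrite eqn_leq; apply/andP; split; last first.
  have [G satG <-] := wsat_attained n T.
  by rewrite leq_subLR add1n num_edges_weakly_saturated ?card_ord.
have leVI : #|V| <= #|[set: 'I_n]| by rewrite cardsT card_ord.
have [g injg _] := exists_injection leVI.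
rewrite -(num_edges_copy_minus_edge injg xy).
by apply/wsat_min/weakly_saturated_pendant_path; rewrite ?card_ord.
Qed.
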